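(* Suppose $X$ is uniformly distributed on $[0,1]^3$ and let $m(x_1,x_2,x_3)=(x_1-0.5)(x_2-0.5)+x_3$. Then the following two statements hold. (a) Let $0\le c_1<c_2\le 1$ and $t=[0,1]^2\times[c_1,c_2]$. Then $\operatorname{Var}(m(X)\mid X\in t)\ge\frac1{144}$ and $\sup_{\mathbf c}\mathbf S_t(\mathbf c)=\frac{(c_2-c_1)^2}{16}\to 0$ as $c_1,c_2\to 0$, where the supremum is over $\mathbf c\in\{1,2,3\}\times[0,1]$. (b) For any $\delta\in(0,\frac23)$ there exists a constant $\alpha_1=\alpha_1(\delta)\ge 1$ such that for any rectangular cell $t=t^{(1)}\times t^{(2)}\times t^{(3)}\subseteq[0,1]^3$, $$\operatorname{Var}(m(X)\mid X\in t)\le\alpha_1\sup_{\mathbf c_1,\mathbf c_2}\mathbf S_t(\mathbf c\mid\mathbf c_1,\mathbf c_2)\quad\text{with probability at least }\delta,$$ where the supremum is over $\mathbf c_1,\mathbf c_2\in\{1,2,3\}\times[0,1]$ and $\mathbf c=(\gamma,U)$ is a random split point with $\gamma$ uniform on $\{1,2,3\}$ and, conditionally on $\gamma=j$, $U$ uniform on $t^{(j)}$.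
   Context: A rectangular cell is a product of intervals of positive length. A cell $t$ is split at $(j,c)$ into $t_1=\{x\in t:x_j\le c\}$ and $t_2=t\setminus t_1$. For a partition $P=\{t_1,\dots,t_L\}$ of $t$, the impurity decrease is $\mathbf S(t;P)=\sum_{l=1}^L\mathbb P(X\in t_l\mid X\in t)[\mu(t_l)-\mu(t)]^2$ with $\mu(A)=\mathbb E[m(X)\mid X\in A]$ (terms with $\mathbb P(X\in t_l)=0$ are $0$). $\mathbf S_t(\mathbf c)$ is $\mathbf S(t;\{t_1,t_2\})$ for the split of $t$ at $\mathbf c$, set to $-\infty$ if $t_1$ or $t_2$ is empty. $\mathbf S_t(\mathbf c\mid\mathbf c_1,\mathbf c_2)$ is $\mathbf S(t;P)$ for the partition $P$ of $t$ into four sets obtained by splitting $t$ at $\mathbf c$ into $t_1,t_2$ and then splitting $t_1$ at $\mathbf c_1$ and $t_2$ at $\mathbf c_2$, set to $-\infty$ if one of the four sets is empty. *)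

(* Defs.v *)
From HB Require Import structures.
From mathcomp Require Import all_boot all_order all_algebra.
From mathcomp Require Import all_classical all_reals all_analysis.

Set Implicit Arguments.
Unset Strict Implicit.
Unset Printing Implicit Defensive.

Import Order.TTheory GRing.Theory Num.Theory.
Import numFieldNormedType.Exports.

Local Open Scope classical_set_scope.
Local Open Scope ring_scope.

(* Points of R^3 are triples ((x_1, x_2), x_3), so that the product sigma-algebra
   and the product measure of the library apply; the coordinates {1, 2, 3} are
   numbered 0, 1, 2. *)
Definition coord (R : realType) (x : R * R * R) (j : 'I_3) : R :=
  tnth [tuple x.1.1; x.1.2; x.2] j.

Definition cell (R : realType) (t : 'I_3 -> interval R) : set (R * R * R) :=
  [set x | forall j, coord x j \in t j].

Definition unit_cube (R : realType) : set (R * R * R) :=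
  cell (fun=> `[0, 1]).

Arguments unit_cube R : clear implicits.

(* [mu] of the unit cube is 1, so no normalization is needed. *)
Definition uniform_on_cube d (Omega : measurableType d) (R : realType)
    (P : probability Omega R) (X : {RV P >-> (R * R * R)%type}) : Prop :=
  let mu := @lebesgue_measure R in
  forall A : set (R * R * R), measurable A ->
    distribution P X A = ((mu \x mu) \x mu)%E (A `&` unit_cube R).

Section conditioning.
Context d (Omega : measurableType d) (R : realType) (P : probability Omega R).

(* P(A | B), E[Y | B] and Var(Y | B) for an event B of positive probability; for
   a null B the value is 0 because x / 0 = 0. *)
Definition cprob (A B : set Omega) : R := fine (P (A `&` B)) / fine (P B).

Definition cexpect (Y : Omega -> R) (B : set Omega) : R :=
  (\int[P]_(w in B) Y w) / fine (P B).

Definition cvar (Y : Omega -> R) (B : set Omega) : R :=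
  cexpect (fun w => (Y w - cexpect Y B) ^+ 2) B.

End conditioning.

(* c = (j, u) splits A at the value u of the coordinate j. *)
Definition split_lo (R : realType) (A : set (R * R * R)) (c : 'I_3 * R) :
  set (R * R * R) := A `&` [set x | coord x c.1 <= c.2].

Definition split_hi (R : realType) (A : set (R * R * R)) (c : 'I_3 * R) :
  set (R * R * R) := A `\` split_lo A c.

Definition split_points (R : realType) : set ('I_3 * R) :=
  [set c | 0 <= c.2 <= 1].

Arguments split_points R : clear implicits.

Section impurity.
Context d (Omega : measurableType d) (R : realType) (P : probability Omega R)
  (X : Omega -> R * R * R) (m : R * R * R -> R).

Definition cell_mean (A : set (R * R * R)) : R :=
  cexpect P (m \o X) (X @^-1` A).

Definition cell_var (A : set (R * R * R)) : R :=
  cvar P (m \o X) (X @^-1` A).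

(* The partition is given as a list; a part of probability 0 contributes 0
   since its weight is 0. *)
Definition impurity_decrease (A : set (R * R * R))
    (parts : seq (set (R * R * R))) : R :=
  \sum_(B <- parts) cprob P (X @^-1` B) (X @^-1` A)
                    * (cell_mean B - cell_mean A) ^+ 2.

Definition impurity_decrease_or_ninfty (A : set (R * R * R))
    (parts : seq (set (R * R * R))) : \bar R :=
  if `[< exists2 B, B \in parts & B = set0 >] then -oo%E
  else (impurity_decrease A parts)%:E.

Definition S1 (A : set (R * R * R)) (c : 'I_3 * R) : \bar R :=
  impurity_decrease_or_ninfty A [:: split_lo A c; split_hi A c].

Definition S2 (A : set (R * R * R)) (c c1 c2 : 'I_3 * R) : \bar R :=
  impurity_decrease_or_ninfty A
    [:: split_lo (split_lo A c) c1; split_hi (split_lo A c) c1;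
        split_lo (split_hi A c) c2; split_hi (split_hi A c) c2].

Definition sup_S1 (A : set (R * R * R)) : \bar R :=
  ereal_sup [set S1 A c | c in split_points R].

Definition sup_S2 (A : set (R * R * R)) (c : 'I_3 * R) : \bar R :=
  ereal_sup [set S2 A c cc.1 cc.2 | cc in split_points R `*` split_points R].

End impurity.

(* gamma is uniform on {1, 2, 3} and, conditionally on gamma = j, U is uniform
   on the interval t j. *)
Definition uniform_random_split d (Omega : measurableType d) (R : realType)
    (Q : probability Omega R) (t : 'I_3 -> interval R)
    (gamma : Omega -> 'I_3) (U : {RV Q >-> R}) : Prop :=
  let mu := @lebesgue_measure R in
  forall j : 'I_3,
    [/\ measurable (gamma @^-1` [set j]),
        Q (gamma @^-1` [set j]) = (3^-1)%:E
      & forall B : set R, measurable B ->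
          cprob Q (U @^-1` B) (gamma @^-1` [set j])
          = fine (mu (B `&` [set` t j])) / fine (mu [set` t j])].

Definition m13 (R : realType) (x : R * R * R) : R :=
  let: (x1, x2, x3) := x in (x1 - 2^-1) * (x2 - 2^-1) + x3.

Arguments m13 {R} x.

(* [0, 1]^2 x [c1, c2] *)
Definition slab (R : realType) (c1 c2 : R) : set (R * R * R) :=
  cell (tnth [tuple `[0, 1]; `[0, 1]; `[c1, c2]]).

(* Main.v *)
Require Import Defs.
From HB Require Import structures.
From mathcomp Require Import all_boot all_order all_algebra.
From mathcomp Require Import all_classical all_reals all_analysis.
From mathcomp Require Import measurable_realfun ring lra.

(** Every set produced by splitting a cell is, up to its faces, a box, so all
    probabilities and averages are explicit. By Fubini ([cell_mean_box],
    [cell_var_box]) the mean of [m13] over a box is its value at the center,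
    and with [a_i] the center coordinates minus 1/2 and [s_i] the side lengths
    the variance is
    [(a_1^2 s_2^2 + a_2^2 s_1^2 + s_3^2)/12 + s_1^2 s_2^2/144].
    An impurity decrease is therefore a sum over the parts of
    volume ratio times squared difference of center values ([box_term]).

    Part (a). In a slab [a_1 = a_2 = 0], so a split of coordinate 1 or 2 leaves
    the center value unchanged and gains nothing, while a split of coordinate 3
    at [u] gains [(u - c1)(c2 - u)/4], which is largest at the middle. The
    variance keeps the interaction term 1/144 whatever the slab.

    Part (b). Suppose that the random split hits a coordinate [j] among the
    first two, at a point [u] that divides the side in proportion at least
    [eps : 1 - eps]; let [k] be the other one of these two, and put
    [w = (u - l_j)(h_j - u)], which is at least [eps (1 - eps) s_j^2].
    Halving both parts along coordinate 3 gives an impurity decrease of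
    [w a_k^2/4 + s_3^2/16], and halving both along [k] gives
    [w a_k^2/4 + s_k^2/16 (a_j^2 + w/4)]. The last summand is the point: after
    the first split the slopes of [m13] in the direction [k] differ in the two
    parts, so that the second split sees the interaction. Together the two
    values dominate each of the four terms of the variance up to a constant
    that depends on [eps] only ([cell_var_le_sup_S2]), and such splits have
    probability [2/3 (1 - 2 eps)], which can be any [delta < 2/3].

    The event of (b) is measurable because, for a fixed coordinate, the
    supremum of the impurity decreases is lower semicontinuous in the split
    point inside the cell ([near_S2_gt]) and is -oo outside of it. *)

Import Order.TTheory GRing.Theory Num.Theory.
Import numFieldNormedType.Exports.

Local Open Scope classical_set_scope.
Local Open Scope ring_scope.

Set Implicit Arguments.
Unset Strict Implicit.
Unset Printing Implicit Defensive.

(** * Integrals of products of functions of one variable *)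

Section product_integral.
Context d1 d2 (T1 : measurableType d1) (T2 : measurableType d2) (R : realType).
Variables (m1 : {sigma_finite_measure set T1 -> \bar R})
  (m2 : {sigma_finite_measure set T2 -> \bar R}).

(** The factors may change sign: by Tonelli the integral of the absolute value
    of the product is the product of two finite integrals, which gives the
    integrability that Fubini's theorem needs. *)
Lemma integrable_mul_prodT (f1 : T1 -> R) (f2 : T2 -> R) :
  m1.-integrable setT (EFin \o f1) -> m2.-integrable setT (EFin \o f2) ->
  (m1 \x m2)%E.-integrable setT (fun z => (f1 z.1 * f2 z.2)%:E).
Proof.
move=> i1 i2.
have mf1 : measurable_fun setT f1 by apply/measurable_EFinP; exact: measurable_int i1.
have mf2 : measurable_fun setT f2 by apply/measurable_EFinP; exact: measurable_int i2.
apply/integrable12ltyP.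
  apply/measurable_EFinP; apply: measurable_funM.
    by apply: measurableT_comp => //; exact: measurable_fst.
  by apply: measurableT_comp => //; exact: measurable_snd.
under eq_integral => x _ /=.
  under eq_integral => y _ do rewrite normrM EFinM.
  rewrite ge0_integralZl//=; last first.
    by apply/measurable_EFinP; exact: measurableT_comp.
  over.
rewrite ge0_integralZr//=; last 2 first.
- by apply/measurable_EFinP; exact: measurableT_comp.
- exact: integral_ge0.
by apply: lte_mul_pinfty; [exact: integral_ge0|
  have /= := integrable_fin_num measurableT (integrable_abse i1)|
  have /= := integrable_lty measurableT (integrable_abse i2)].
Qed.

Lemma Rintegral_mul_prodT (f1 : T1 -> R) (f2 : T2 -> R) :
  m1.-integrable setT (EFin \o f1) -> m2.-integrable setT (EFin \o f2) ->
  \int[(m1 \x m2)%E]_z (f1 z.1 * f2 z.2) =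
  (\int[m1]_x f1 x) * (\int[m2]_y f2 y).
Proof.
move=> i1 i2; rewrite {1}/Rintegral.
rewrite -(integral12_prod_meas1 (integrable_mul_prodT i1 i2)).
rewrite (eq_integral (fun x => (f1 x)%:E * (\int[m2]_y f2 y)%:E)%E); last first.
  move=> x _; rewrite /fubini_F /=.
  under eq_integral => y _ do rewrite EFinM.
  by rewrite (integralZl measurableT i2) fineK//; exact: integrable_fin_num.
by rewrite (integralZr measurableT i1) fineM//; exact: integrable_fin_num.
Qed.

Lemma patch_mul_prod (D1 : set T1) (D2 : set T2) (f1 : T1 -> R) (f2 : T2 -> R) :
  (fun z => f1 z.1 * f2 z.2) \_ (D1 `*` D2) =
  (fun z => (f1 \_ D1) z.1 * (f2 \_ D2) z.2).
Proof.
apply/funext => -[x y]; rewrite /patch/= in_setX/=.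
by case: (x \in D1); case: (y \in D2); rewrite ?mulr0 ?mul0r.
Qed.

Lemma integrable_mul_prod D1 D2 (f1 : T1 -> R) (f2 : T2 -> R) :
  measurable D1 -> measurable D2 ->
  m1.-integrable D1 (EFin \o f1) -> m2.-integrable D2 (EFin \o f2) ->
  (m1 \x m2)%E.-integrable (D1 `*` D2) (EFin \o (fun z => f1 z.1 * f2 z.2)) /\
  \int[(m1 \x m2)%E]_(z in D1 `*` D2) (f1 z.1 * f2 z.2) =
  (\int[m1]_(x in D1) f1 x) * (\int[m2]_(y in D2) f2 y).
Proof.
move=> mD1 mD2 /(integrable_mkcond _ mD1); rewrite restrict_EFin => i1.
move=> /(integrable_mkcond _ mD2); rewrite restrict_EFin => i2.
split.
  apply/(integrable_mkcond _ (measurableX mD1 mD2)).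
  rewrite restrict_EFin patch_mul_prod; exact: integrable_mul_prodT.
rewrite Rintegral_mkcond patch_mul_prod Rintegral_mul_prodT//.
by rewrite -!Rintegral_mkcond.
Qed.

End product_integral.

Section box_integral.
Context {R : realType}.
Local Notation mu := (@lebesgue_measure R).

Lemma continuous_shifted_pow (c : R) n : continuous (fun x : R => (x - c) ^+ n).
Proof.
move=> x; apply: (@continuous_comp _ _ _ (fun y => y - c) (fun y => y ^+ n)).
  by apply: cvgB; [exact: cvg_id|exact: cvg_cst].
exact: exprn_continuous.
Qed.

Lemma integrable_shifted_pow (a b c : R) n :
  mu.-integrable `[a, b] (EFin \o (fun x => (x - c) ^+ n)).
Proof.
apply: continuous_compact_integrable; first exact: segment_compact.
exact: continuous_subspaceT (@continuous_shifted_pow c n).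
Qed.

Lemma Rintegral_shifted_pow (a b c : R) n : a < b ->
  \int[mu]_(x in `[a, b]) (x - c) ^+ n =
  ((b - c) ^+ n.+1 - (a - c) ^+ n.+1) / n.+1%:R.
Proof.
move=> ab; pose F x := n.+1%:R^-1 * (x - c) ^+ n.+1.
have dF (x : R) : is_derive x 1 F ((x - c) ^+ n).
  have dX := is_deriveX n.+1 (is_deriveB (is_derive_id x 1) (is_derive_cst c x 1)).
  have -> : F = n.+1%:R^-1 \*: ((id - cst c) ^+ n.+1).
    by apply/funext => y; rewrite /F/= fctE.
  apply: (is_derive_eq (is_deriveZ n.+1%:R^-1 dX)).
  by rewrite /= subr0 /GRing.scale/= mulr1 mulrA mulVf ?mul1r// pnatr_eq0.
rewrite /Rintegral (@continuous_FTC2 _ _ F)//=.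
- by rewrite /F; ring.
- exact: continuous_subspaceT (@continuous_shifted_pow c n).
- have cF x : {for x, continuous F}.
    apply: differentiable_continuous; apply/derivable1_diffP.
    apply: (@ex_derive _ _ _ _ _ _ _ (dF x)).
  split => //.
  + by apply: cvg_at_right_filter; exact: cF.
  + by apply: cvg_at_left_filter; exact: cF.
- by move=> x _; rewrite derive1E; apply: derive_val.
Qed.

End box_integral.

(** * Boxes and their moments under Lebesgue measure *)

(* Coordinates of a point of [R * R * R], not of a vector in a basis. *)
Local Notation coord := Defs.coord.

Local Notation x1 := (@Ordinal 3 0 isT).
Local Notation x2 := (@Ordinal 3 1 isT).
Local Notation x3 := (@Ordinal 3 2 isT).

Lemma forall_ord3 (Q : 'I_3 -> Prop) : Q x1 -> Q x2 -> Q x3 -> forall j, Q j.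
Proof.
move=> q1 q2 q3 [[|[|[|//]]] lt_i3].
- by rewrite (_ : Ordinal lt_i3 = x1)//; exact: val_inj.
- by rewrite (_ : Ordinal lt_i3 = x2)//; exact: val_inj.
- by rewrite (_ : Ordinal lt_i3 = x3)//; exact: val_inj.
Qed.

Section boxes.
Context {R : realType}.
Local Notation mu := (@lebesgue_measure R).
Local Notation mu3 := ((mu \x mu) \x mu)%E.
Implicit Types (t : 'I_3 -> interval R) (l h : 'I_3 -> R) (B : set (R * R * R)).

Lemma cellE t : cell t = [set` t x1] `*` [set` t x2] `*` [set` t x3].
Proof.
apply/seteqP; split=> -[[a b] c].
  by move=> tx; split; [split|]; [exact: (tx x1)|exact: (tx x2)|exact: (tx x3)].
by case=> -[ta tb] tc; apply: forall_ord3.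
Qed.

Lemma measurable_cell t : measurable (cell t).
Proof. by rewrite cellE; apply: measurableX => //; apply: measurableX. Qed.

Lemma measurable_coord (j : 'I_3) :
  measurable_fun setT (fun x : R * R * R => coord x j).
Proof.
elim/forall_ord3: j.
- exact: (measurableT_comp measurable_fst measurable_fst).
- exact: (measurableT_comp measurable_snd measurable_fst).
- exact: measurable_snd.
Qed.

Definition volume l h : R := (h x1 - l x1) * (h x2 - l x2) * (h x3 - l x3).

(** The value at the center of the box, which is also the average of [m13]
    over the box since [m13] is affine in each coordinate. *)
Definition center_value l h : R :=
  m13 ((l x1 + h x1) / 2, (l x2 + h x2) / 2, (l x3 + h x3) / 2).

Definition closed_box l h : set (R * R * R) := cell (fun j => `[l j, h j]).
Definition open_box l h : set (R * R * R) := cell (fun j => `]l j, h j[).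

(** Splitting produces boxes with some faces included and others not; only the
    bounds matter for probabilities and averages. *)
Definition box_like l h B :=
  [/\ measurable B, open_box l h `<=` B & B `<=` closed_box l h].

Lemma mu3_cell l h (b b' : bool) : (forall j, l j <= h j) ->
  mu3 (cell (fun j => Interval (BSide b (l j)) (BSide b' (h j)))) =
  (volume l h)%:E.
Proof.
move=> lh; rewrite cellE product_measure1E//; last exact: measurableX.
rewrite [X in (X * _)%E]product_measure1E//= !lebesgue_measure_itv/= !lte_fin.
have e (x y : R) : x <= y -> (if x < y then (y - x)%:E else 0%E) = (y - x)%:E.
  by case: ltgtP => // -> _; rewrite subrr.
by rewrite !e.
Qed.

Lemma mu3_box l h B : (forall j, l j <= h j) -> box_like l h B ->
  mu3 B = (volume l h)%:E.
Proof.
move=> lh [mB oB Bc]; apply/eqP; rewrite eq_le; apply/andP; split.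
  rewrite -(mu3_cell true false lh); apply: le_measure => //; rewrite inE//.
  exact: measurable_cell.
rewrite -(mu3_cell false true lh); apply: le_measure => //; rewrite inE//.
exact: measurable_cell.
Qed.

Lemma mu3_box_boundary l h B : (forall j, l j <= h j) -> box_like l h B ->
  mu3 (closed_box l h `\` B) = 0%E.
Proof.
move=> lh bB; have [mB oB Bc] := bB.
transitivity (mu3 (closed_box l h) - mu3 B)%E.
  rewrite -[in RHS](setIidr Bc); apply: measureD => //.
    exact: measurable_cell.
  by apply: le_lt_trans (ltry (volume l h)); rewrite -(mu3_cell true false lh); exact: lexx.
by rewrite (mu3_box lh bB) mu3_cell// subee.
Qed.

Lemma integral_box l h B (f : R * R * R -> R) : (forall j, l j <= h j) ->
  box_like l h B -> mu3.-integrable (closed_box l h) (EFin \o f) ->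
  \int[mu3]_(x in B) f x = \int[mu3]_(x in closed_box l h) f x.
Proof.
move=> lh bB intf; have [mB oB Bc] := bB.
rewrite /Rintegral [in RHS](negligible_integral _ _ intf (mu3_box_boundary lh bB)).
- by congr (fine (integral _ _ _)); rewrite setDD setIidr.
- by apply: measurableD => //; exact: measurable_cell.
- exact: measurable_cell.
Qed.

(** Lebesgue measure of the plane, named so that it carries the sigma-finite
    structure that Fubini's theorem asks for when the third coordinate is
    added. *)
Definition plane_measure : set (measurableTypeR R * measurableTypeR R) -> \bar R :=
  (mu \x mu)%E.

HB.instance Definition _ := Measure.on plane_measure.

HB.instance Definition _ := Measure_isSigmaFinite.Build _ _ _ plane_measure
  (lebesgue_integral_fubini.product_measure_sigma_finite_subproof mu mu).

Definition has_box_integral l h (f : R * R * R -> R) (I : R) :=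
  [/\ measurable_fun setT f, mu3.-integrable (closed_box l h) (EFin \o f)
    & \int[mu3]_(x in closed_box l h) f x = I].

(** Fubini: a product of powers of the coordinates factors. *)
Lemma has_box_integral_monomial l h (c1 c2 c3 : R) (n1 n2 n3 : nat) :
  (forall j, l j < h j) ->
  has_box_integral l h
    (fun x => (x.1.1 - c1) ^+ n1 * (x.1.2 - c2) ^+ n2 * (x.2 - c3) ^+ n3)
    (((h x1 - c1) ^+ n1.+1 - (l x1 - c1) ^+ n1.+1) / n1.+1%:R *
     (((h x2 - c2) ^+ n2.+1 - (l x2 - c2) ^+ n2.+1) / n2.+1%:R) *
     (((h x3 - c3) ^+ n3.+1 - (l x3 - c3) ^+ n3.+1) / n3.+1%:R)).
Proof.
move=> lh.
have [i12 e12] := @integrable_mul_prod _ _ _ _ _ mu mu `[l x1, h x1] `[l x2, h x2]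
  _ _ (measurable_itv _) (measurable_itv _)
  (integrable_shifted_pow (l x1) (h x1) c1 n1)
  (integrable_shifted_pow (l x2) (h x2) c2 n2).
have [i123 e123] := @integrable_mul_prod _ _ _ _ _ plane_measure mu
  (`[l x1, h x1] `*` `[l x2, h x2]) `[l x3, h x3] _ _
  (measurableX (measurable_itv _) (measurable_itv _)) (measurable_itv _) i12
  (integrable_shifted_pow (l x3) (h x3) c3 n3).
split; rewrite /closed_box ?cellE; [|exact: i123|].
  apply: measurable_funM; [apply: measurable_funM|]; apply: measurable_funX;
    apply: measurable_funB => //.
  - exact: (measurable_coord x1).
  - exact: (measurable_coord x2).
by rewrite e123 e12 !Rintegral_shifted_pow.
Qed.

Lemma has_box_integralD l h f1 f2 (I1 I2 : R) :
  has_box_integral l h f1 I1 -> has_box_integral l h f2 I2 ->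
  has_box_integral l h (fun x => f1 x + f2 x) (I1 + I2).
Proof.
case=> m1 i1 <- [m2 i2 <-]; have mc := measurable_cell (fun j => `[l j, h j]).
split; [exact: measurable_funD| |exact: (RintegralD (mu := mu3) mc i1 i2)].
have := integrableD (mu := mu3) mc i1 i2.
by apply: eq_integrable => // x _; rewrite /= EFinD.
Qed.

Lemma has_box_integralZ l h k f (I : R) :
  has_box_integral l h f I -> has_box_integral l h (fun x => k * f x) (k * I).
Proof.
case=> mf intf <-; have mc := measurable_cell (fun j => `[l j, h j]).
split; [exact: measurable_funM| |exact: (RintegralZl (mu := mu3) _ mc intf)].
have := integrableZl (mu := mu3) mc k intf.
by apply: eq_integrable => // x _; rewrite /= EFinM.
Qed.

End boxes.

(** * Mean and variance of the regression function on a box *)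

Lemma Rintegral_preimage d d' (Omega : measurableType d) (T : measurableType d')
    (R : realType) (P : {measure set Omega -> \bar R}) (m : {measure set T -> \bar R})
    (X : Omega -> T) (B : set T) (f : T -> R) :
  measurable_fun setT X -> measurable B -> measurable_fun setT f ->
  (forall A, measurable A -> A `<=` B -> P (X @^-1` A) = m A) ->
  m.-integrable B (EFin \o f) ->
  \int[P]_(w in X @^-1` B) f (X w) = \int[m]_(x in B) f x.
Proof.
move=> mX mB mf PX intf.
have eqI (g : T -> \bar R) :
    (\int[m]_(x in B) g x = \int[pushforward P X]_(x in B) g x)%E.
  by apply: esym; apply: eq_measure_integral => A mA AB; exact: PX.
have mf' : measurable_fun setT (EFin \o f) by exact/measurable_EFinP.
rewrite /Rintegral eqI integral_pushforward//.
apply/integrableP; split; first exact/measurable_funTS/measurableT_comp.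
have /integrableP[_] := intf.
by rewrite eqI ge0_integral_pushforward//; exact/measurable_funTS/measurableT_comp.
Qed.

Section uniform.
Context {d} {Omega : measurableType d} {R : realType} {P : probability Omega R}.
Context {X : {RV P >-> (R * R * R)%type}} (HX : uniform_on_cube X).
Local Notation mu := (@lebesgue_measure R).
Local Notation mu3 := ((mu \x mu) \x mu)%E.
Implicit Types (l h : 'I_3 -> R) (B : set (R * R * R)).

Lemma closed_box_cube l h : (forall j, 0 <= l j) -> (forall j, h j <= 1) ->
  closed_box l h `<=` unit_cube R.
Proof.
move=> l0 h1 x xlh j; have := xlh j; rewrite !in_itv/= => /andP[lx xh].
by rewrite (le_trans (l0 j) lx) (le_trans xh (h1 j)).
Qed.

Lemma prob_box l h B : (forall j, 0 <= l j) -> (forall j, l j <= h j) ->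
  (forall j, h j <= 1) -> box_like l h B -> P (X @^-1` B) = (volume l h)%:E.
Proof.
move=> l0 lh h1 bB; have [mB _ Bc] := bB.
have := HX mB; rewrite /distribution /pushforward => ->.
rewrite setIidl; first exact: mu3_box.
exact: subset_trans Bc (closed_box_cube l0 h1).
Qed.

Lemma integral_preimage_box l h B (f : R * R * R -> R) :
  (forall j, 0 <= l j) -> (forall j, l j <= h j) -> (forall j, h j <= 1) ->
  box_like l h B -> measurable_fun setT f ->
  mu3.-integrable (closed_box l h) (EFin \o f) ->
  \int[P]_(w in X @^-1` B) f (X w) = \int[mu3]_(x in closed_box l h) f x.
Proof.
move=> l0 lh h1 bB mf intf; have [mB _ Bc] := bB.
have mX : measurable_fun setT X by exact: measurable_funPT.
rewrite -(integral_box lh bB intf).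
apply: (Rintegral_preimage (m := mu3) (P := P) mX mB mf).
  move=> A mA AB; apply: etrans (HX mA) _.
  rewrite setIidl//; apply: subset_trans AB _.
  exact: subset_trans Bc (closed_box_cube l0 h1).
by apply: integrableS intf => //; exact: measurable_cell.
Qed.

Section positive_volume.
Variables (l h : 'I_3 -> R) (B : set (R * R * R)).
Hypotheses (l0 : forall j, 0 <= l j) (lh : forall j, l j < h j)
  (h1 : forall j, h j <= 1) (bB : box_like l h B).

Lemma volume_gt0 : 0 < volume l h.
Proof. by rewrite /volume !mulr_gt0// subr_gt0. Qed.

Let lhW j : l j <= h j. Proof. exact/ltW/lh. Qed.

Lemma fine_prob_box : fine (P (X @^-1` B)) = volume l h.
Proof. by rewrite (prob_box l0 lhW h1 bB). Qed.

Lemma cexpect_box (f : R * R * R -> R) (I : R) :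
  has_box_integral l h f (I * volume l h) ->
  cexpect P (f \o X) (X @^-1` B) = I.
Proof.
case=> mf intf fI; rewrite /cexpect fine_prob_box.
rewrite (integral_preimage_box l0 lhW h1 bB mf intf) fI mulfK//.
by rewrite gt_eqF// volume_gt0.
Qed.

Lemma cell_mean_box : cell_mean P X m13 B = center_value l h.
Proof.
rewrite /cell_mean; apply: cexpect_box.
have := has_box_integralD (has_box_integral_monomial 2^-1 2^-1 0 1 1 0 lh)
  (has_box_integral_monomial 0 0 0 0 0 1 lh).
rewrite (_ : (fun x => _) = m13); last first.
  by apply/funext => -[[a b] c]; rewrite /m13/=; ring.
by congr has_box_integral; rewrite /center_value /m13 /volume; field.
Qed.

(** With [a_i] the center coordinates minus 1/2 and [y_i] the coordinates
    relative to the center, [m13] minus its mean is the sum of the four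
    uncorrelated terms [a_1 y_2], [a_2 y_1], [y_3] and [y_1 y_2]. *)
Lemma cell_var_box : cell_var P X m13 B =
  (((l x1 + h x1) / 2 - 2^-1) ^+ 2 * (h x2 - l x2) ^+ 2 +
   ((l x2 + h x2) / 2 - 2^-1) ^+ 2 * (h x1 - l x1) ^+ 2 +
   (h x3 - l x3) ^+ 2) / 12 + (h x1 - l x1) ^+ 2 * (h x2 - l x2) ^+ 2 / 144.
Proof.
rewrite /cell_var /cvar; have := cell_mean_box; rewrite /cell_mean => ->.
set c := center_value l h.
apply: (cexpect_box (f := fun x => (m13 x - c) ^+ 2)).
have := has_box_integralD
  (has_box_integralD (has_box_integral_monomial 2^-1 2^-1 0 2 2 0 lh)
                     (has_box_integral_monomial 0 0 c 0 0 2 lh))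
  (has_box_integralZ 2 (has_box_integral_monomial 2^-1 2^-1 c 1 1 1 lh)).
rewrite (_ : (fun x => _) = fun x => (m13 x - c) ^+ 2); last first.
  by apply/funext => -[[a b] e]; rewrite /m13/=; ring.
by congr has_box_integral; rewrite /c /center_value /m13 /volume; field.
Qed.

End positive_volume.
End uniform.

(** * Splits of boxes and impurity decreases *)

Section splits.
Context {R : realType}.
Implicit Types (l h : 'I_3 -> R) (B : set (R * R * R)) (c : 'I_3 * R).

Definition lower_bound_at h c : 'I_3 -> R :=
  fun i => if i == c.1 then Num.min (h i) c.2 else h i.

Definition raise_bound_at l c : 'I_3 -> R :=
  fun i => if i == c.1 then Num.max (l i) c.2 else l i.

Definition cube_box l h B :=
  [/\ forall j, 0 <= l j, forall j, h j <= 1 & box_like l h B].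

Lemma measurable_split_lo B c : measurable B -> measurable (split_lo B c).
Proof.
move=> mB; apply: measurableI => //.
have := measurable_coord c.1 measurableT (measurable_itv `]-oo, c.2]).
by rewrite setTI; congr measurable; apply/seteqP; split => x /=; rewrite in_itv.
Qed.

Lemma split_hiE B c x : split_hi B c x <-> B x /\ c.2 < coord x c.1.
Proof.
split=> [[Bx] /not_andP[//|/negP]|[Bx cx]]; first by rewrite -ltNge.
by split=> // -[_] /=; rewrite leNgt cx.
Qed.

Lemma cube_box_split_lo l h B c : cube_box l h B ->
  cube_box l (lower_bound_at h c) (split_lo B c).
Proof.
case=> l0 h1 [mB oB Bc]; split=> //.
  by move=> j; rewrite /lower_bound_at; case: ifP => // _; rewrite ge_min h1.
split; first exact: measurable_split_lo.
- move=> x ox; split.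
    apply: oB => j; have := ox j; rewrite !in_itv/= /lower_bound_at.
    by case: ifP => // _; rewrite lt_min => /and3P[-> ->].
  have := ox c.1; rewrite !in_itv/= /lower_bound_at eqxx lt_min.
  by move=> /and3P[_ _ /ltW].
- move=> x [/Bc Bx xc] j; have := Bx j; rewrite !in_itv/= /lower_bound_at.
  by case: eqP => // -> /andP[-> xh]; rewrite le_min xh.
Qed.

Lemma cube_box_split_hi l h B c : cube_box l h B ->
  cube_box (raise_bound_at l c) h (split_hi B c).
Proof.
case=> l0 h1 [mB oB Bc]; split=> //.
  by move=> j; rewrite /raise_bound_at; case: ifP => // _; rewrite le_max l0.
split; first by apply: measurableD => //; exact: measurable_split_lo.
- move=> x ox; apply/split_hiE; split.
    apply: oB => j; have := ox j; rewrite !in_itv/= /raise_bound_at.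
    by case: ifP => // _; rewrite gt_max -andbA => /and3P[-> _ ->].
  have := ox c.1; rewrite !in_itv/= /raise_bound_at eqxx gt_max.
  by move=> /andP[/andP[]].
- move=> x /split_hiE[/Bc Bx xc] j; have := Bx j; rewrite !in_itv/= /raise_bound_at.
  by case: eqP => // -> /andP[lx ->]; rewrite ge_max lx ltW.
Qed.

Lemma cube_box_le l h B : cube_box l h B -> B !=set0 -> forall j, l j <= h j.
Proof.
case=> _ _ [_ _ Bc] [x /Bc Bx] j.
by have := Bx j; rewrite in_itv/= => /andP[/le_trans]; apply.
Qed.

Lemma cube_box_neq0 l h B : cube_box l h B -> (forall j, l j < h j) -> B !=set0.
Proof.
case=> _ _ [_ oB _] lh; pose m j := (l j + h j) / 2.
exists (m x1, m x2, m x3).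
have mP j : m j \in `]l j, h j[ by rewrite in_itv/= /m; have := lh j; lra.
by apply: oB => j; elim/forall_ord3: j; [exact: (mP x1)|exact: (mP x2)|exact: (mP x3)].
Qed.

(** The contribution of a part with bounds [l], [h] to the impurity decrease:
    a polynomial in these bounds, which vanishes with the volume, as does the
    term of a part of probability 0. *)
Definition box_term lA hA l h : R :=
  volume l h / volume lA hA * (center_value l h - center_value lA hA) ^+ 2.

Lemma box_term_continuous lA hA (l h : R -> 'I_3 -> R) :
  (forall i, continuous (fun u => l u i)) ->
  (forall i, continuous (fun u => h u i)) ->
  continuous (fun u => box_term lA hA (l u) (h u)).
Proof.
move=> cl ch u.
have cmid i : (l v i + h v i) / 2 @[v --> u] --> (l u i + h u i) / 2.
  by apply: cvgM; [apply: cvgD; [exact: cl|exact: ch]|exact: cvg_cst].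
have cside i : h v i - l v i @[v --> u] --> h u i - l u i.
  by apply: cvgB; [exact: ch|exact: cl].
have cvol : volume (l v) (h v) @[v --> u] --> volume (l u) (h u).
  by apply: cvgM; [apply: cvgM|]; exact: cside.
have ccen : center_value (l v) (h v) @[v --> u] --> center_value (l u) (h u).
  apply: cvgD; last exact: cmid.
  by apply: cvgM; apply: cvgB; [exact: cmid|exact: cvg_cst|exact: cmid|exact: cvg_cst].
apply: cvgM; first by apply: cvgM => //; exact: cvg_cst.
by rewrite expr2; under eq_fun do rewrite expr2;
  apply: cvgM; apply: cvgB => //; exact: cvg_cst.
Qed.

Lemma lower_bound_at_continuous (h : R -> 'I_3 -> R) j (v : R -> R) i :
  (forall i, continuous (fun u => h u i)) -> continuous v ->
  continuous (fun u => lower_bound_at (h u) (j, v u) i).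
Proof.
rewrite /lower_bound_at/= => ch cv; case: (i == j) => // u.
by apply: continuous_min; [exact: ch|exact: cv].
Qed.

Lemma raise_bound_at_continuous (l : R -> 'I_3 -> R) j (v : R -> R) i :
  (forall i, continuous (fun u => l u i)) -> continuous v ->
  continuous (fun u => raise_bound_at (l u) (j, v u) i).
Proof.
rewrite /raise_bound_at/= => cl cv; case: (i == j) => // u.
by apply: continuous_max; [exact: cl|exact: cv].
Qed.

End splits.

Section impurity_of_boxes.
Context {d} {Omega : measurableType d} {R : realType} {P : probability Omega R}.
Context {X : {RV P >-> (R * R * R)%type}} (HX : uniform_on_cube X).
Variables (lA hA : 'I_3 -> R) (A : set (R * R * R)).
Hypotheses (bA : cube_box lA hA A) (lhA : forall j, lA j < hA j).

Lemma part_term l h B : cube_box l h B -> B `<=` A -> B !=set0 ->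
  cprob P (X @^-1` B) (X @^-1` A) * (cell_mean P X m13 B - cell_mean P X m13 A) ^+ 2
  = box_term lA hA l h.
Proof.
move=> bB BA B0; have lh := cube_box_le bB B0.
case: bB => l0 h1 bB; case: bA => lA0 hA1 bA'.
rewrite /cprob setIidl; last by move=> w; exact: BA.
rewrite (fine_prob_box HX lA0 lhA hA1 bA') (prob_box HX l0 lh h1 bB)/=.
have [lh'|] := pselect (forall j, l j < h j).
  by rewrite /box_term (cell_mean_box HX l0 lh' h1 bB) (cell_mean_box HX lA0 lhA hA1 bA').
move=> /existsNP[j /negP]; rewrite -leNgt => hl.
have e : h j = l j by apply/eqP; rewrite eq_le hl lh.
suff v0 : volume l h = 0 by rewrite /box_term v0 !mul0r.
by rewrite /volume; elim/forall_ord3: j e {hl} => ->; rewrite subrr ?mul0r ?mulr0 ?mul0r.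
Qed.

Lemma impurity_ninfty (parts : seq (set (R * R * R))) B :
  B \in parts -> ~ (B !=set0) ->
  impurity_decrease_or_ninfty P X m13 A parts = -oo%E.
Proof.
move=> Bp B0; rewrite /impurity_decrease_or_ninfty; case: asboolP => // -[].
by exists B => //; apply/eqP/negPn/negP => /set0P.
Qed.

Lemma impurity_fin (parts : seq (set (R * R * R))) :
  (forall B, B \in parts -> B !=set0) ->
  impurity_decrease_or_ninfty P X m13 A parts = (impurity_decrease P X m13 A parts)%:E.
Proof.
move=> p0; rewrite /impurity_decrease_or_ninfty; case: asboolP => // -[B /p0 + B0].
by rewrite B0 => -[].
Qed.

Lemma S1_box c : split_lo A c !=set0 -> split_hi A c !=set0 ->
  S1 P X m13 A c = (box_term lA hA lA (lower_bound_at hA c) +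
                    box_term lA hA (raise_bound_at lA c) hA)%:E.
Proof.
move=> lo0 hi0; rewrite /S1 impurity_fin => [|B]; last by rewrite !inE => /orP[] /eqP ->.
rewrite /impurity_decrease !big_cons big_nil addr0.
rewrite (part_term (cube_box_split_lo c bA)) ?(part_term (cube_box_split_hi c bA))//.
- by move=> x [].
- by move=> x [].
Qed.

Definition S2_value c c1 c2 : R :=
  box_term lA hA lA (lower_bound_at (lower_bound_at hA c) c1) +
  box_term lA hA (raise_bound_at lA c1) (lower_bound_at hA c) +
  box_term lA hA (raise_bound_at lA c) (lower_bound_at hA c2) +
  box_term lA hA (raise_bound_at (raise_bound_at lA c) c2) hA.

Lemma S2_box c c1 c2 :
  split_lo (split_lo A c) c1 !=set0 -> split_hi (split_lo A c) c1 !=set0 ->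
  split_lo (split_hi A c) c2 !=set0 -> split_hi (split_hi A c) c2 !=set0 ->
  S2 P X m13 A c c1 c2 = (S2_value c c1 c2)%:E.
Proof.
move=> p1 p2 p3 p4; rewrite /S2 impurity_fin => [|B]; last first.
  by rewrite !inE => /or4P[] /eqP ->.
rewrite /impurity_decrease !big_cons big_nil addr0 /S2_value !addrA.
have bl := cube_box_split_lo c bA; have bh := cube_box_split_hi c bA.
rewrite (part_term (cube_box_split_lo c1 bl))//; last by move=> x [[]].
rewrite (part_term (cube_box_split_hi c1 bl))//; last by move=> x [[]].
rewrite (part_term (cube_box_split_lo c2 bh))//; last by move=> x [[]].
by rewrite (part_term (cube_box_split_hi c2 bh))//; move=> x [[]].
Qed.

End impurity_of_boxes.

(** * Slabs: one level of splits misses the interaction *)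

Section slab.
Context {d} {Omega : measurableType d} {R : realType} {P : probability Omega R}.
Context {X : {RV P >-> (R * R * R)%type}} (HX : uniform_on_cube X).

Section fixed_slab.
Variables (c1 c2 : R).
Hypotheses (c1_ge0 : 0 <= c1) (c12 : c1 < c2) (c2_le1 : c2 <= 1).

Let l : 'I_3 -> R := tnth [tuple 0; 0; c1].
Let h : 'I_3 -> R := tnth [tuple 1; 1; c2].

Let lh j : l j < h j.
Proof. by elim/forall_ord3: j; rewrite /l /h !(tnth_nth 0)/= ?ltr01. Qed.

Let bA : cube_box l h (slab c1 c2).
Proof.
have bounds j : tnth [tuple `[0, 1]; `[0, 1]; `[c1, c2]] j = `[l j, h j].
  by elim/forall_ord3: j.
split.
- by elim/forall_ord3.
- by elim/forall_ord3; rewrite /h (tnth_nth 0)/=.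
split; first exact: measurable_cell.
  move=> x ox j; have := ox j; rewrite /= bounds; exact: subset_itv_oo_cc.
by move=> x sx j; rewrite -bounds.
Qed.

Lemma cell_var_slab : 144^-1 <= cell_var P X m13 (slab c1 c2).
Proof.
case: bA => l0 h1 bA'; rewrite (cell_var_box HX l0 lh h1 bA') /l /h !(tnth_nth 0)/=.
have := sqr_ge0 (c2 - c1); lra.
Qed.

Lemma sup_S1_slab : sup_S1 P X m13 (slab c1 c2) = ((c2 - c1) ^+ 2 / 16)%:E.
Proof.
have c210 : c2 - c1 != 0 by rewrite subr_eq0 gt_eqF.
apply/eqP; rewrite eq_le; apply/andP; split.
  apply: ge_ereal_sup => _ [[j u] _ <-].
  have [lo0|lo0] := pselect (split_lo (slab c1 c2) (j, u) !=set0); last first.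
    by rewrite /S1 (impurity_ninfty _ _ lo0) ?leNye// !inE eqxx.
  have [hi0|hi0] := pselect (split_hi (slab c1 c2) (j, u) !=set0); last first.
    by rewrite /S1 (impurity_ninfty _ _ hi0) ?leNye// !inE eqxx orbT.
  rewrite (S1_box HX bA lh lo0 hi0) lee_fin.
  have := cube_box_le (cube_box_split_lo (j, u) bA) lo0 j.
  have := cube_box_le (cube_box_split_hi (j, u) bA) hi0 j.
  have sq0 := sqr_ge0 (c2 - c1).
  rewrite /box_term /volume /center_value /m13 /lower_bound_at /raise_bound_at /l /h !(tnth_nth 0)/=.
  elim/forall_ord3: j {lo0 hi0} => /=.
  - move=> _ _; rewrite [X in _ * X ^+ 2 + _](_ : _ = 0); last by field.
    rewrite [X in _ + _ * X ^+ 2](_ : _ = 0); last by field.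
    by lra.
  - move=> _ _; rewrite [X in _ * X ^+ 2 + _](_ : _ = 0); last by field.
    rewrite [X in _ + _ * X ^+ 2](_ : _ = 0); last by field.
    by lra.
  rewrite ge_max le_min => /andP[_ uc2] /andP[_ c1u].
  rewrite (min_idPr uc2) (max_idPr c1u).
  rewrite [leLHS](_ : _ = (u - c1) * (c2 - u) / 4); last by field.
  rewrite -subr_ge0 [leRHS](_ : _ = (c2 + c1 - 2 * u) ^+ 2 / 16); last by field.
  by rewrite divr_ge0// sqr_ge0.
pose c := (x3, (c1 + c2) / 2) : 'I_3 * R.
have lt12 := c12; have le0 := c1_ge0; have le1 := c2_le1.
have cl : c1 < c.2 by rewrite /c/=; lra.
have ch : c.2 < c2 by rewrite /c/=; lra.
have lo0 : split_lo (slab c1 c2) c !=set0.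
  apply: cube_box_neq0 (cube_box_split_lo c bA) _.
  by elim/forall_ord3; rewrite /lower_bound_at /l /h !(tnth_nth 0)/= ?ltr01// lt_min cl c12.
have hi0 : split_hi (slab c1 c2) c !=set0.
  apply: cube_box_neq0 (cube_box_split_hi c bA) _.
  by elim/forall_ord3; rewrite /raise_bound_at /l /h !(tnth_nth 0)/= ?ltr01// gt_max ch c12.
apply: ereal_sup_ge; exists (S1 P X m13 (slab c1 c2) c).
  by exists c => //; rewrite /split_points/=; lra.
rewrite (S1_box HX bA lh lo0 hi0) lee_fin.
rewrite /box_term /volume /center_value /m13 /lower_bound_at /raise_bound_at /l /h !(tnth_nth 0)/=.
rewrite (min_idPr (ltW ch)) (max_idPr (ltW cl)) /c/=.
by rewrite le_eqVlt; apply/orP; left; apply/eqP; field.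
Qed.

End fixed_slab.

Lemma sup_S1_slab_cvg0 :
  sup_S1 P X m13 (slab c.1 c.2)
    @[c --> within [set c : R * R | [/\ 0 <= c.1, c.1 < c.2 & c.2 <= 1]]
                   (nbhs ((0, 0) : R * R))] --> 0%E.
Proof.
set D := [set c : R * R | _].
apply: (@cvg_trans _ (((c.2 - c.1) ^+ 2 / 16)%:E @[c --> within D (nbhs ((0, 0) : R * R))])).
  apply: near_eq_cvg; near=> c.
  have [c0 c12 c1] : D c by near: c; exact: withinT.
  exact/esym/sup_S1_slab.
apply: cvg_within_filter.
rewrite (_ : 0%E = ((0 - 0) ^+ 2 / 16)%:E :> \bar R); last by rewrite subr0 expr0n/= mul0r.
apply: cvg_EFin; first exact: nearW.
apply: cvgM; last exact: cvg_cst.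
rewrite expr2; under eq_fun do rewrite expr2.
have c21 : (fun c : R * R => c.2 - c.1) @ ((0, 0) : R * R) --> (0 - 0 : R).
  by apply: cvgB; [exact: cvg_snd|exact: cvg_fst].
exact: cvgM.
Unshelve. all: by end_near. Qed.

End slab.

(** * Dependence of the impurity decrease on the first split point *)

Lemma interval_bounds (R : realType) (i : interval R) :
  (0 < lebesgue_measure [set` i])%E -> [set` i] `<=` `[0, 1] ->
  exists a b : R, [/\ 0 <= a, a < b, b <= 1, `]a, b[ `<=` [set` i]
    & [set` i] `<=` `[a, b]].
Proof.
move=> i_gt0 i01; set S := [set` i].
have S0 : S !=set0.
  by apply/set0P/eqP => S0; move: i_gt0; rewrite -/S S0 measure0 ltxx.
have S01 x : S x -> 0 <= x <= 1 by move=> /i01; rewrite /= in_itv.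
have lb : has_lbound S by exists 0 => x /S01/andP[].
have ub : has_ubound S by exists 1 => x /S01/andP[].
have Sab : S `<=` `[inf S, sup S].
  by move=> x Sx; rewrite /= in_itv/= (ge_inf lb Sx) (ub_le_sup ub Sx).
exists (inf S), (sup S); split=> //.
- by apply: lb_le_inf => // x /S01/andP[].
- rewrite ltNge; apply/negP => ba; move: i_gt0; rewrite ltNge => /negP; apply.
  apply: (@le_trans _ _ (lebesgue_measure (`[inf S, sup S] : set R))).
    by apply: le_measure => //; rewrite inE.
  by rewrite lebesgue_measure_itv/= lte_fin ltNge ba.
- by apply: ge_sup => // x /S01/andP[].
- rewrite -interval_bounded_interior//; last exact: interval_is_interval.
  exact: interior_subset.
Qed.

Section split_stability.
Context {R : realType}.
Implicit Types (t : 'I_3 -> interval R) (A W : set (R * R * R)) (c : 'I_3 * R).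

Lemma cube_box_cell t (l h : 'I_3 -> R) :
  (forall j, 0 <= l j) -> (forall j, h j <= 1) ->
  (forall j, `]l j, h j[ `<=` [set` t j]) ->
  (forall j, [set` t j] `<=` `[l j, h j]) -> cube_box l h (cell t).
Proof.
move=> l0 h1 oi ic; split=> //; split; first exact: measurable_cell.
  by move=> x ox j; exact/oi/ox.
by move=> x tx j; exact/ic/tx.
Qed.

(** The inner split can be done before the outer one, so that only the last
    operation depends on a moving outer split point. *)
Lemma split_lo_lo A c c' : split_lo (split_lo A c) c' = split_lo (split_lo A c') c.
Proof. exact: setIAC. Qed.

Lemma split_hi_lo A c c' : split_hi (split_lo A c) c' = split_lo (split_hi A c') c.
Proof.
apply/seteqP; split=> x.
  by move=> /split_hiE[[Ax xc] xc']; split=> //; apply/split_hiE.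
by move=> [/split_hiE[Ax xc'] xc]; apply/split_hiE.
Qed.

Lemma split_hi_hi A c c' : split_hi (split_hi A c) c' = split_hi (split_hi A c') c.
Proof.
apply/seteqP; split=> x /split_hiE[/split_hiE[Ax xc] xc'].
  by apply/split_hiE; split=> //; apply/split_hiE.
by apply/split_hiE; split=> //; apply/split_hiE.
Qed.

Lemma near_split_hi W j (u : R) : split_hi W (j, u) !=set0 ->
  \forall v \near u, split_hi W (j, v) !=set0.
Proof.
move=> [x /split_hiE[Wx ux]]; near=> v; exists x; apply/split_hiE; split=> //=.
by near: v; exact: lt_nbhsl.
Unshelve. all: by end_near. Qed.

Lemma near_split_lo W j (u : R) : (exists2 x, W x & coord x j < u) ->
  \forall v \near u, split_lo W (j, v) !=set0.
Proof.
move=> [x Wx xu]; near=> v; exists x; split=> //=.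
by apply: ltW; near: v; exact: lt_nbhsr.
Unshelve. all: by end_near. Qed.

Definition set_coord (x : R * R * R) (j : 'I_3) (z : R) : R * R * R :=
  let y i := if i == j then z else coord x i in (y x1, y x2, y x3).

Lemma coord_set_coord x j z i :
  coord (set_coord x j z) i = if i == j then z else coord x i.
Proof. by elim/forall_ord3: i. Qed.

(** A point on the face [x_j = u] can be moved slightly below that face without
    leaving the cell, nor the half-space of the other split. *)
Lemma split_lo_below t l h c j (u : R) :
  (forall i, `]l i, h i[ `<=` [set` t i]) -> l j < u < h j ->
  split_lo (split_lo (cell t) c) (j, u) !=set0 ->
  exists2 x, split_lo (cell t) c x & coord x j < u.
Proof.
move=> lht /andP[lu uh] [x [[tx xc] /= xu]].
move: xu; rewrite le_eqVlt => /predU1P[xu|xu]; last by exists x.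
exists (set_coord x j ((l j + u) / 2)).
  split=> [i|/=]; rewrite coord_set_coord; case: eqP => [e|_] //.
    by rewrite e; apply: lht; rewrite /= in_itv/=; lra.
  by apply: le_trans xc; rewrite e xu; lra.
by rewrite coord_set_coord eqxx; lra.
Qed.

Lemma split_hi_below t l h c j (u : R) :
  (forall i, `]l i, h i[ `<=` [set` t i]) -> l j < u < h j ->
  split_lo (split_hi (cell t) c) (j, u) !=set0 ->
  exists2 x, split_hi (cell t) c x & coord x j < u.
Proof.
move=> lht /andP[lu uh] [x [/split_hiE[tx xc] /= xu]].
move: xu; rewrite le_eqVlt => /predU1P[xu|xu]; last first.
  by exists x => //; apply/split_hiE.
pose w := if c.1 == j then Num.max (l j) c.2 else l j.
have lw : l j <= w by rewrite /w; case: ifP => // _; rewrite le_max lexx.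
have wu : w < u.
  by rewrite /w; case: ifP => [/eqP cj|//]; rewrite gt_max lu -xu -cj.
have cw : c.1 == j -> c.2 <= w by rewrite /w => ->; rewrite le_max lexx orbT.
exists (set_coord x j ((w + u) / 2)).
  apply/split_hiE; split=> [i|]; rewrite coord_set_coord; case: eqP => [e|_] //.
    by rewrite e; apply: lht; rewrite /= in_itv/=; lra.
  by have := cw (introT eqP e); lra.
by rewrite coord_set_coord eqxx; lra.
Qed.

End split_stability.

Section cell.
Context {d} {Omega : measurableType d} {R : realType} {P : probability Omega R}.
Context {X : {RV P >-> (R * R * R)%type}} (HX : uniform_on_cube X).
Context (t : 'I_3 -> interval R) (l h : 'I_3 -> R).
Hypotheses (l_ge0 : forall j, 0 <= l j) (lh : forall j, l j < h j)
  (h_le1 : forall j, h j <= 1) (oi : forall j, `]l j, h j[ `<=` [set` t j])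
  (ic : forall j, [set` t j] `<=` `[l j, h j]).

Let bA := cube_box_cell l_ge0 h_le1 oi ic.

Let S2t c c1 c2 := S2 P X m13 (cell t) c c1 c2.

Lemma S2_gt_nonempty c c1 c2 (a : R) : (a%:E < S2t c c1 c2)%E ->
  [/\ split_lo (split_lo (cell t) c) c1 !=set0, split_hi (split_lo (cell t) c) c1 !=set0,
      split_lo (split_hi (cell t) c) c2 !=set0 & split_hi (split_hi (cell t) c) c2 !=set0].
Proof.
move=> aS; have nonempty B : B \in [:: split_lo (split_lo (cell t) c) c1;
    split_hi (split_lo (cell t) c) c1; split_lo (split_hi (cell t) c) c2;
    split_hi (split_hi (cell t) c) c2] -> B !=set0.
  by move=> Bp; apply: contrapT => B0; move: aS; rewrite /S2t /S2 (impurity_ninfty _ Bp B0).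
by split; apply: nonempty; rewrite !inE eqxx ?orbT.
Qed.

Lemma S2_value_continuous j c1 c2 :
  continuous (fun u => S2_value l h (j, u) c1 c2).
Proof.
have cu : continuous (fun u : R => u) by move=> u; exact: cvg_id.
have cc (k : R) : continuous (fun _ : R => k) by move=> u; exact: cvg_cst.
have clo (f : R -> 'I_3 -> R) c i : (forall i, continuous (fun u => f u i)) ->
    continuous (fun u => lower_bound_at (f u) c i).
  by case: c => k v cf; apply: (@lower_bound_at_continuous _ f k (fun=> v) i) => //; exact: cc.
have chi (f : R -> 'I_3 -> R) c i : (forall i, continuous (fun u => f u i)) ->
    continuous (fun u => raise_bound_at (f u) c i).
  by case: c => k v cf; apply: (@raise_bound_at_continuous _ f k (fun=> v) i) => //; exact: cc.
have clu i : continuous (fun u => lower_bound_at h (j, u) i).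
  by apply: (@lower_bound_at_continuous _ (fun=> h) j (fun u => u)) => // k; exact: cc.
have chu i : continuous (fun u => raise_bound_at l (j, u) i).
  by apply: (@raise_bound_at_continuous _ (fun=> l) j (fun u => u)) => // k; exact: cc.
move=> u; apply: cvgD; [apply: cvgD; [apply: cvgD|]|].
- apply: (@box_term_continuous _ l h (fun=> l)
    (fun u => lower_bound_at (lower_bound_at h (j, u)) c1)) => i; first exact: cc.
  exact: (clo (fun u => lower_bound_at h (j, u))).
- apply: (@box_term_continuous _ l h (fun=> raise_bound_at l c1)
    (fun u => lower_bound_at h (j, u))) => i; first exact: cc.
  exact: clu.
- apply: (@box_term_continuous _ l h (fun u => raise_bound_at l (j, u))
    (fun=> lower_bound_at h c2)) => i; last exact: cc.
  exact: chu.
- apply: (@box_term_continuous _ l h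
    (fun u => raise_bound_at (raise_bound_at l (j, u)) c2) (fun=> h)) => i; last exact: cc.
  exact: (chi (fun u => raise_bound_at l (j, u))).
Qed.

(** Lower semicontinuity of the impurity decrease in the outer split point:
    it is continuous where it is finite, and inside the cell a part that is not
    empty stays so under a small move of that point. *)
Lemma near_S2_gt j (u : R) c1 c2 (a : R) : l j < u < h j ->
  (a%:E < S2t (j, u) c1 c2)%E ->
  \forall v \near u, (a%:E < S2t (j, v) c1 c2)%E.
Proof.
move=> lu aS; have [p1 p2 p3 p4] := S2_gt_nonempty aS.
move: aS; rewrite /S2t (S2_box HX bA lh p1 p2 p3 p4) lte_fin => aS.
have n1 := near_split_lo (split_lo_below oi lu
  (eq_ind _ (fun W => W !=set0) p1 _ (split_lo_lo _ _ _))).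
have n2 := near_split_lo (split_hi_below oi lu
  (eq_ind _ (fun W => W !=set0) p2 _ (split_hi_lo _ _ _))).
have n3 : \forall v \near u, split_hi (split_lo (cell t) c2) (j, v) !=set0.
  by apply: near_split_hi; rewrite split_hi_lo.
have n4 : \forall v \near u, split_hi (split_hi (cell t) c2) (j, v) !=set0.
  by apply: near_split_hi; rewrite split_hi_hi.
have nv := cvgr_gt _ (@S2_value_continuous j c1 c2 u) _ aS.
near=> v; rewrite (S2_box HX bA lh) ?lte_fin; first by near: v; exact: nv.
- by rewrite split_lo_lo; near: v.
- by rewrite split_hi_lo; near: v.
- by rewrite -split_hi_lo; near: v.
- by rewrite split_hi_hi; near: v.
Unshelve. all: by end_near. Qed.

Lemma sup_S2_outside j (u : R) : ~~ (l j <= u <= h j) ->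
  sup_S2 P X m13 (cell t) (j, u) = -oo%E.
Proof.
move=> out; apply/eqP; rewrite -leeNy_eq; apply: ge_ereal_sup => _ [[c1 c2] _ <-].
have tj x : cell t x -> l j <= coord x j <= h j.
  by move=> /(_ j) tx; have := ic tx; rewrite /= in_itv.
move: out; rewrite negb_and -!ltNge => /orP[ul|hu].
  rewrite /S2 (@impurity_ninfty _ _ _ _ _ _ _ (split_lo (split_lo (cell t) (j, u)) c1))//.
    by rewrite !inE eqxx.
  move=> [x [[/tj/andP[lx _] /= xu] _]].
  by have := le_lt_trans (le_trans lx xu) ul; rewrite ltxx.
rewrite /S2 (@impurity_ninfty _ _ _ _ _ _ _ (split_hi (split_hi (cell t) (j, u)) c2))//.
  by rewrite !inE eqxx !orbT.
move=> [x /split_hiE[/split_hiE[/tj/andP[_ xh] /= ux] _]].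
by have := lt_le_trans (lt_trans hu ux) xh; rewrite ltxx.
Qed.

Lemma measurable_sup_S2_ge j (V alpha : R) : 0 < alpha ->
  measurable [set u | (V%:E <= alpha%:E * sup_S2 P X m13 (cell t) (j, u))%E].
Proof.
move=> a0; set E := [set u | _].
pose g u := if l j < u < h j then sup_S2 P X m13 (cell t) (j, u) else -oo%E.
have mg : measurable_fun setT g.
  apply: lower_semicontinuous_measurable => u a; rewrite /g; case: ifP => // lu.
  move=> /ereal_sup_gt[_ [[c1 c2] cc <-] /(near_S2_gt lu) aS].
  have /andP[lu1 lu2] := lu.
  exists [set v | (a%:E < g v)%E] => //; near=> v => /=.
  have lv : l j < v < h j.
    apply/andP; split.
      by near: v; exact: lt_nbhsr.
    by near: v; exact: lt_nbhsl.
  rewrite /g lv; apply: (@lt_le_trans _ _ (S2t (j, v) c1 c2)); first by near: v; exact: aS.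
  by apply: ereal_sup_ubound; exists (c1, c2).
have -> : E = (`]l j, h j[ `&` [set u | (V%:E <= alpha%:E * g u)%E]) `|`
              ([set l j; h j] `&` E).
  apply/seteqP; split=> u.
    move=> Eu; have [lu|lu] := boolP (l j < u < h j).
      by left; split; rewrite /= ?in_itv//= /g lu.
    right; split=> //; have [|/sup_S2_outside e] := boolP (l j <= u <= h j).
      move: lu; rewrite negb_and -!leNgt => /orP[ul|hu] /andP[lu uh]; [left|right];
      by apply/eqP; rewrite eq_le ?ul ?uh ?lu ?hu.
    by move: Eu; rewrite /E/= e mulrNy gtr0_sg// mul1e leeNy_eq.
  by move=> [[/=]|[]//]; rewrite in_itv/= /g => ->.
apply: measurableU; first apply: measurableI => //.
  have := measurable_funeM alpha%:E mg measurableT (emeasurable_itv `[V%:E, +oo[).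
  by rewrite setTI; congr measurable; apply/seteqP; split=> u /=; rewrite in_itv/= andbT.
apply: countable_measurable => //; apply: finite_set_countable.
by apply: sub_finite_set (_ : [set l j; h j] `&` E `<=` [set l j; h j]) _ => [x []//|].
Unshelve. all: by end_near. Qed.

End cell.

(** * Two levels of splits detect the interaction *)

Section good_splits.
Context {d} {Omega : measurableType d} {R : realType} {P : probability Omega R}.
Context {X : {RV P >-> (R * R * R)%type}} (HX : uniform_on_cube X).
Implicit Types (l h : 'I_3 -> R) (j k : 'I_3).

Lemma lt_lower_bound_at l h c : (forall i, l i < h i) -> l c.1 < c.2 ->
  forall i, l i < lower_bound_at h c i.
Proof.
move=> lh lc i; rewrite /lower_bound_at; case: eqP => [->|_]; last exact: lh.
by rewrite lt_min lh lc.
Qed.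

Lemma raise_bound_at_lt l h c : (forall i, l i < h i) -> c.2 < h c.1 ->
  forall i, raise_bound_at l c i < h i.
Proof.
move=> lh ch i; rewrite /raise_bound_at; case: eqP => [->|_]; last exact: lh.
by rewrite gt_max lh ch.
Qed.

Definition mid l h k : R := (l k + h k) / 2.

Lemma sup_S2_ge_mid l h A j k (u : R) : cube_box l h A -> (forall i, l i < h i) ->
  k != j -> l j < u < h j ->
  ((S2_value l h (j, u) (k, mid l h k) (k, mid l h k))%:E <=
   sup_S2 P X m13 A (j, u))%E.
Proof.
move=> bA lh /negbTE kj /andP[lu uh]; set c := (k, mid l h k).
have [lm mh] : l k < c.2 /\ c.2 < h k by have := lh k; rewrite /c/mid/=; split; lra.
have lu' := @lt_lower_bound_at l h (j, u) lh lu.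
have uh' := @raise_bound_at_lt l h (j, u) lh uh.
have bl := cube_box_split_lo (j, u) bA; have bh := cube_box_split_hi (j, u) bA.
rewrite -(S2_box HX bA lh).
- apply: ereal_sup_ubound; exists (c, c) => //.
  have := bA => -[/(_ k) l0 /(_ k) h1 _].
  by split; rewrite /split_points/=; move: lm mh; rewrite /c/= => lm mh; lra.
- by apply: cube_box_neq0 (cube_box_split_lo c bl) _; exact: lt_lower_bound_at.
- apply: cube_box_neq0 (cube_box_split_hi c bl) _; apply: raise_bound_at_lt => //.
  by rewrite /lower_bound_at /c/= kj.
- apply: cube_box_neq0 (cube_box_split_lo c bh) _; apply: lt_lower_bound_at => //.
  by rewrite /raise_bound_at /c/= kj.
- by apply: cube_box_neq0 (cube_box_split_hi c bh) _; exact: raise_bound_at_lt.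
Qed.

(** The two factors of the interaction play symmetric roles. *)
Definition product_coords j k := (j = x1 /\ k = x2) \/ (j = x2 /\ k = x1).

(** The outer split gains from the linear effect of coordinate [j]; halving both
    parts along the additive coordinate gains 3/4 of the variance due to it. *)
Lemma S2_value_additive l h j k (u : R) : (forall i, l i < h i) ->
  product_coords j k -> l j < u < h j ->
  S2_value l h (j, u) (x3, mid l h x3) (x3, mid l h x3) =
  (u - l j) * (h j - u) * (mid l h k - 2^-1) ^+ 2 / 4 + (h x3 - l x3) ^+ 2 / 16.
Proof.
move=> lh jk /andP[lu uh].
have n1 : h x1 - l x1 != 0 by rewrite subr_eq0 gt_eqF.
have n2 : h x2 - l x2 != 0 by rewrite subr_eq0 gt_eqF.
have n3 : h x3 - l x3 != 0 by rewrite subr_eq0 gt_eqF.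
have [lm mh] : l x3 <= mid l h x3 /\ mid l h x3 <= h x3.
  by have := lh x3; rewrite /mid; split; lra.
have e1 := min_idPr (ltW uh); have e2 := max_idPr (ltW lu).
case: jk lu uh e1 e2 => -[-> ->] lu uh e1 e2;
  rewrite /S2_value /box_term /volume /center_value /m13;
  rewrite /lower_bound_at /raise_bound_at/= e1 e2 (min_idPr mh) (max_idPr lm) /mid;
  by field; rewrite n1 n2 n3.
Qed.

(** Halving both parts along the coordinate of the other factor: in a part
    centered at [x_j = 1/2 + a], the average of [m13] over the coordinates other
    than [k] has slope [a] in [x_k]. The mean square of the two slopes exceeds
    the square of their mean by the variance [(u - l_j)(h_j - u)/4] that the
    outer split creates. This is how two levels of splits detect an interaction
    invisible to one. *)
Lemma S2_value_product l h j k (u : R) : (forall i, l i < h i) ->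
  product_coords j k -> l j < u < h j ->
  S2_value l h (j, u) (k, mid l h k) (k, mid l h k) =
  (u - l j) * (h j - u) * (mid l h k - 2^-1) ^+ 2 / 4 +
  (h k - l k) ^+ 2 / 16 * ((mid l h j - 2^-1) ^+ 2 + (u - l j) * (h j - u) / 4).
Proof.
move=> lh jk /andP[lu uh].
have n1 : h x1 - l x1 != 0 by rewrite subr_eq0 gt_eqF.
have n2 : h x2 - l x2 != 0 by rewrite subr_eq0 gt_eqF.
have n3 : h x3 - l x3 != 0 by rewrite subr_eq0 gt_eqF.
have [lm mh] : l k <= mid l h k /\ mid l h k <= h k.
  by have := lh k; rewrite /mid; split; lra.
have e1 := min_idPr (ltW uh); have e2 := max_idPr (ltW lu).
have e3 := min_idPr mh; have e4 := max_idPr lm.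
case: jk lu uh e1 e2 e3 e4 => -[-> ->] lu uh e1 e2 e3 e4;
  rewrite /S2_value /box_term /volume /center_value /m13;
  rewrite /lower_bound_at /raise_bound_at/= e1 e2 e3 e4 /mid;
  by field; rewrite n1 n2 n3.
Qed.

(** With [w >= sigma * s1^2], the sum of the two impurity decreases dominates
    [sigma/64] times the sum of the four products of squares in the variance,
    which is at most 1/12 of that sum. Hence the constant: the larger of the
    two is at least half their sum, and [2 * 64 / 12 = 32/3]. *)
Lemma variance_bound (sigma w a1 a2 s1 s2 s3 : R) :
  0 < sigma -> sigma <= 4^-1 -> sigma * s1 ^+ 2 <= w ->
  (a1 ^+ 2 * s2 ^+ 2 + a2 ^+ 2 * s1 ^+ 2 + s3 ^+ 2) / 12 +
    s1 ^+ 2 * s2 ^+ 2 / 144 <=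
  32 / (3 * sigma) *
    Num.max (w * a2 ^+ 2 / 4 + s3 ^+ 2 / 16)
      (w * a2 ^+ 2 / 4 + s2 ^+ 2 / 16 * (a1 ^+ 2 + w / 4)).
Proof.
move=> s_gt0 s_le w_ge; set V := leLHS.
set i := w * _ / _ + s3 ^+ 2 / _; set ii := _ + s2 ^+ 2 / 16 * _.
have sum : 3 * sigma / 16 * V <= i + ii.
  have p1 : 0 <= (w - sigma * s1 ^+ 2) * a2 ^+ 2.
    by rewrite mulr_ge0 ?sqr_ge0// subr_ge0.
  have p2 : 0 <= (w - sigma * s1 ^+ 2) * s2 ^+ 2.
    by rewrite mulr_ge0 ?sqr_ge0// subr_ge0.
  have p3 : 0 <= (4^-1 - sigma) * (a1 ^+ 2 * s2 ^+ 2).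
    by apply: mulr_ge0; [rewrite subr_ge0|rewrite mulr_ge0 ?sqr_ge0].
  have p4 : 0 <= (4^-1 - sigma) * s3 ^+ 2 by rewrite mulr_ge0 ?sqr_ge0// subr_ge0.
  have p5 : 0 <= sigma * (a2 ^+ 2 * s1 ^+ 2).
    by apply: mulr_ge0; [exact: ltW|rewrite mulr_ge0 ?sqr_ge0].
  have p6 : 0 <= sigma * (s1 ^+ 2 * s2 ^+ 2).
    by apply: mulr_ge0; [exact: ltW|rewrite mulr_ge0 ?sqr_ge0].
  have p7 : 0 <= a1 ^+ 2 * s2 ^+ 2 by rewrite mulr_ge0 ?sqr_ge0.
  have p8 := sqr_ge0 s3.
  by rewrite /i /ii /V; lra.
have le_max2 : i + ii <= 2 * Num.max i ii.
  by rewrite mulr_natl mulr2n lerD// le_max lexx ?orbT.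
rewrite -[leLHS](_ : 32 / (3 * sigma) * (3 * sigma / 16 * V / 2) = V); last first.
  by field; rewrite gt_eqF.
rewrite ler_wpM2l ?divr_ge0 ?mulr_ge0 ?ler0n ?(ltW s_gt0)//.
by rewrite ler_pdivrMr// [leRHS]mulrC (le_trans sum).
Qed.

Lemma cell_var_le_sup_S2 l h A j k (eps u : R) : 0 < eps -> eps < 2^-1 ->
  cube_box l h A -> (forall i, l i < h i) -> product_coords j k ->
  l j + eps * (h j - l j) <= u <= h j - eps * (h j - l j) ->
  ((cell_var P X m13 A)%:E <=
   (32 / (3 * (eps * (1 - eps))))%:E * sup_S2 P X m13 A (j, u))%E.
Proof.
move=> e0 e1 bA lh jk /andP[lu uh].
have L0 : 0 < h j - l j by rewrite subr_gt0.
have eL0 : 0 < eps * (h j - l j) by rewrite mulr_gt0.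
have inside : l j < u < h j by apply/andP; split; lra.
have s0 : 0 < eps * (1 - eps) by rewrite mulr_gt0// subr_gt0; lra.
have s1 : eps * (1 - eps) <= 4^-1.
  rewrite -subr_ge0 [leRHS](_ : _ = (2^-1 - eps) ^+ 2) ?sqr_ge0//; by field.
have w_ge : eps * (1 - eps) * (h j - l j) ^+ 2 <= (u - l j) * (h j - u).
  rewrite -subr_ge0 [leRHS](_ : _ = (u - (l j + eps * (h j - l j))) *
    (h j - eps * (h j - l j) - u)); last by ring.
  by rewrite mulr_ge0// subr_ge0.
have kj : k != j by case: jk => -[-> ->].
have x3j : x3 != j by case: jk => -[-> _].
have := sup_S2_ge_mid bA lh x3j inside.
rewrite (S2_value_additive lh jk inside) => ge1.
have := sup_S2_ge_mid bA lh kj inside.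
rewrite (S2_value_product lh jk inside) => ge2.
have := variance_bound (mid l h j - 2^-1) (mid l h k - 2^-1) (h k - l k)
  (h x3 - l x3) s0 s1 w_ge.
set M := Num.max _ _ => VM.
have MS : (M%:E <= sup_S2 P X m13 A (j, u))%E.
  by rewrite /M /Num.max /Order.max; case: ifP.
apply: (@le_trans _ _ ((32 / (3 * (eps * (1 - eps))))%:E * M%:E)%E); last first.
  by rewrite lee_wpmul2l// lee_fin divr_ge0 ?mulr_ge0 ?ler0n// ltW//; lra.
case: bA => l0 h1 bA; rewrite (cell_var_box HX l0 lh h1 bA) -EFinM lee_fin.
apply: le_trans VM; rewrite le_eqVlt; apply/orP; left; apply/eqP.
by case: jk => -[-> ->]; rewrite /mid; field.
Qed.

End good_splits.

Section random_split.
Context {d} {Omega : measurableType d} {R : realType} {Q : probability Omega R}.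
Context (t : 'I_3 -> interval R) (gamma : Omega -> 'I_3) (U : {RV Q >-> R}).
Hypothesis HU : uniform_random_split t gamma U.
Local Notation mu := (@lebesgue_measure R).

Lemma measurable_split_event (j : 'I_3) (B : set R) : measurable B ->
  measurable (gamma @^-1` [set j] `&` U @^-1` B).
Proof.
move=> mB; have [mg _ _] := HU j; apply: measurableI => //.
by rewrite -[X in measurable X]setTI; exact: measurable_funPT.
Qed.

Lemma prob_split_event (j : 'I_3) (a b l h : R) : l < h ->
  `]l, h[ `<=` [set` t j] -> [set` t j] `<=` `[l, h] -> l < a -> a <= b -> b < h ->
  Q (gamma @^-1` [set j] `&` U @^-1` `[a, b]) = ((b - a) / (3 * (h - l)))%:E.
Proof.
move=> lh oi ic la ab bh; have [mg Qg /(_ [set` `[a, b]] (measurable_itv _))] := HU j.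
have mut : mu [set` t j] = (h - l)%:E.
  apply/eqP; rewrite eq_le; apply/andP; split.
    apply: (@le_trans _ _ (mu `[l, h])); first by apply: le_measure => //; rewrite inE.
    by rewrite lebesgue_measure_itv/= lte_fin lh.
  apply: (@le_trans _ _ (mu `]l, h[)); last by apply: le_measure => //; rewrite inE.
  by rewrite lebesgue_measure_itv/= lte_fin lh.
rewrite setIidl; last first.
  move=> x /=; rewrite in_itv/= => /andP[ax xb]; apply: oi.
  by rewrite /= in_itv/= (lt_le_trans la ax) (le_lt_trans xb bh).
rewrite mut lebesgue_measure_itv/= lte_fin.
rewrite (_ : fine _ = b - a); last first.
  by case: ltP => //= ba; apply/esym/eqP; rewrite subr_eq0 eq_le ab ba.
rewrite /cprob Qg/= setIC => e.
rewrite -[LHS]fineK; last by rewrite fin_num_measure//; exact: measurable_split_event.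
congr _%:E; have n0 : h - l != 0 by rewrite subr_eq0 gt_eqF.
rewrite -[LHS](mulfK (_ : (3 : R) != 0)) ?pnatr_eq0//.
move: e; rewrite invrK => ->; by field.
Qed.

End random_split.

(** * Both statements *)

Unset Implicit Arguments.

Theorem proposition13 (R : realType) (d : measure_display)
    (Omega : measurableType d) (P : probability Omega R)
    (X : {RV P >-> (R * R * R)%type}) (HX : uniform_on_cube X) :
  (* (a) *)
  [/\ forall c1 c2 : R, 0 <= c1 -> c1 < c2 -> c2 <= 1 ->
        144^-1 <= cell_var P X m13 (slab c1 c2) /\
        sup_S1 P X m13 (slab c1 c2) = ((c2 - c1) ^+ 2 / 16)%:E
    & sup_S1 P X m13 (slab c.1 c.2)
        @[c --> within [set c : R * R | [/\ 0 <= c.1, c.1 < c.2 & c.2 <= 1]]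
                       (nbhs ((0, 0) : R * R))] --> 0%E] /\
  (* (b) *)
  forall delta : R, 0 < delta -> delta < 2 / 3 ->
    exists2 alpha1 : R, 1 <= alpha1 &
      forall t : 'I_3 -> interval R,
        (forall j, (0 < lebesgue_measure [set` t j])%E) ->
        cell t `<=` unit_cube R ->
        forall (d' : measure_display) (Omega' : measurableType d')
               (Q : probability Omega' R)
               (gamma : Omega' -> 'I_3) (U : {RV Q >-> R}),
          uniform_random_split t gamma U ->
          let E := [set w | ((cell_var P X m13 (cell t))%:E <=
            alpha1%:E * sup_S2 P X m13 (cell t) (gamma w, U w))%E] in
          measurable E /\ (delta%:E <= Q E)%E.
Proof.
split.
  split; last exact: sup_S1_slab_cvg0.
  by move=> c1 c2 c1_ge0 c12 c2_le1; split; [exact: cell_var_slab|exact: sup_S1_slab].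
move=> delta delta_gt0 delta_lt.
(* Makes the relative positions in [eps, 1 - eps] a fraction [3 delta / 2] of
   each side; two coordinates of probability 1/3 then add up to [delta]. *)
pose eps := (1 - 3 / 2 * delta) / 2.
have eps_gt0 : 0 < eps by rewrite /eps; lra.
have eps_lt : eps < 2^-1 by rewrite /eps; lra.
have sigma_gt0 : 0 < eps * (1 - eps) by rewrite mulr_gt0//; lra.
have sigma_le : eps * (1 - eps) <= 1 by rewrite -[leRHS]mulr1 ler_pM//; lra.
exists (32 / (3 * (eps * (1 - eps)))).
  by rewrite ler_pdivlMr ?mulr_gt0//; lra.
set alpha := 32 / _.
move=> t t_gt0 t_cube d' Omega' Q gamma U HU.
have t_nonempty j : [set` t j] !=set0.
  by apply/set0P/eqP => t0; have := t_gt0 j; rewrite t0 measure0 ltxx.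
have [p tp] := choice t_nonempty.
(* Each factor of the cell lies in [0, 1], because the other factors are not
   empty. *)
have t01 j : [set` t j] `<=` `[0, 1].
  move=> z tz; have : cell t (set_coord (p x1, p x2, p x3) j z).
    move=> i; rewrite coord_set_coord; case: eqP => [->//|_].
    by elim/forall_ord3: i; exact: tp.
  by move=> /t_cube /(_ j); rewrite coord_set_coord eqxx.
have [l /choice[h lhP]] := choice (fun j => interval_bounds (t_gt0 j) (t01 j)).
have l0 j : 0 <= l j by case: (lhP j).
have lh j : l j < h j by case: (lhP j).
have h1 j : h j <= 1 by case: (lhP j).
have oi j : `]l j, h j[ `<=` [set` t j] by case: (lhP j).
have ic j : [set` t j] `<=` `[l j, h j] by case: (lhP j).
have bA := cube_box_cell l0 h1 oi ic.
set V := cell_var P X m13 (cell t).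
pose Eu j := [set u | (V%:E <= alpha%:E * sup_S2 P X m13 (cell t) (j, u))%E].
set E := [set w | _].
have alpha_gt0 : 0 < alpha by apply: divr_gt0 => //; apply: mulr_gt0.
have mEu j : measurable (gamma @^-1` [set j] `&` U @^-1` Eu j).
  apply: (measurable_split_event HU).
  exact: (measurable_sup_S2_ge HX l0 lh h1 oi ic).
have EE : E = (gamma @^-1` [set x1] `&` U @^-1` Eu x1) `|`
              (gamma @^-1` [set x2] `&` U @^-1` Eu x2) `|`
              (gamma @^-1` [set x3] `&` U @^-1` Eu x3).
  apply/seteqP; split=> w; last by move=> [[|]|] [/= <-].
  move=> Ew; have : (gamma @^-1` [set gamma w] `&` U @^-1` Eu (gamma w)) w by [].
  by elim/forall_ord3: (gamma w) => ?; [left; left|left; right|right].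
have mE : measurable E by rewrite EE; apply: measurableU => //; exact: measurableU.
split=> //.
pose G j := gamma @^-1` [set j] `&`
  U @^-1` `[l j + eps * (h j - l j), h j - eps * (h j - l j)].
have mG j : measurable (G j) by exact: (measurable_split_event HU).
have QG j : Q (G j) = (delta / 2)%:E.
  have L0 : 0 < h j - l j by rewrite subr_gt0.
  have eL : 0 < eps * (h j - l j) by rewrite mulr_gt0.
  have eL2 : eps * (h j - l j) <= (h j - l j) / 2.
    by rewrite mulrC ler_pM2l// ltW.
  rewrite /G (prob_split_event HU (lh j) (oi j) (ic j)); [|lra|lra|lra].
  by congr _%:E; rewrite /eps; field; rewrite gt_eqF.
have GE j k : product_coords j k -> G j `<=` E.
  move=> jk w [/= gw]; rewrite in_itv/= => Uw.
  change (V%:E <= alpha%:E * sup_S2 P X m13 (cell t) (gamma w, U w))%E.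
  by rewrite gw; exact: (cell_var_le_sup_S2 HX eps_gt0 eps_lt bA lh jk Uw).
have -> : delta%:E = Q (G x1 `|` G x2).
  transitivity (Q (G x1) + Q (G x2))%E; first by rewrite !QG -EFinD -splitr.
  apply/esym/measureU => //.
  by apply/seteqP; split=> // w [[/= g1 _] [/= g2 _]]; rewrite g1 in g2.
apply: le_measure; rewrite ?inE//; first exact: measurableU.
by move=> w [/(GE x1 x2)|/(GE x2 x1)]; apply; [left|right].
Qed.
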